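(* For every integer $d\ge 1$ there exists a finite poset $P$ with $\operatorname{ldim}(P)>d$ such that the cover graph of $P$ has tree-width at most $3$.
   Context: The cover graph of a poset $P$ is the graph on its ground set in which $x,y$ are adjacent iff one covers the other. A partial linear extension (ple) of $P$ is a linear extension of a subposet of $P$. For a family $\mathcal{L}$ of ple's and $u\in P$, $\mu(u,\mathcal{L})$ is the number of members of $\mathcal{L}$ containing $u$, and $\mu(\mathcal{L})=\max_u\mu(u,\mathcal{L})$. A non-empty family $\mathcal{L}$ of ple's is a local realizer of $P$ if (1) whenever $x\le y$ in $P$ there is $L\in\mathcal{L}$ with $x\le y$ in $L$, and (2) whenever $x,y$ are incomparable in $P$ there is $L\in\mathcal{L}$ with $x>y$ in $L$. The local dimension $\operatorname{ldim}(P)$ is the minimum of $\mu(\mathcal{L})$ over all local realizers $\mathcal{L}$ of $P$. Tree-width is the usual graph parameter. *)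

(* Defs.v *)
From mathcomp Require Import all_boot all_order.
From mathcomp Require Import boolp.

Set Implicit Arguments.
Unset Strict Implicit.
Unset Printing Implicit Defensive.

Import Order.TTheory.

Section Poset.
Context {disp : Order.disp_t} {P : finPOrderType disp}.
Implicit Types (x y u : P) (L : seq P) (Ls : seq (seq P)).

Definition covers x y : bool :=
  (x < y)%O && [forall z : P, ~~ ((x < z)%O && (z < y)%O)].

Definition cover_graph : rel P := [rel x y | covers x y || covers y x].

Lemma cover_graph_sym : symmetric cover_graph.
Proof. by move=> x y; rewrite /cover_graph /= orbC. Qed.

Lemma cover_graph_irr : irreflexive cover_graph.
Proof. by move=> x; rewrite /cover_graph /= /covers ltxx. Qed.

(* A linear order on a subset of P is encoded by the duplicate-free list of
   the elements of this subset, in increasing order. *)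
Definition le_in L x y : bool :=
  [&& x \in L, y \in L & index x L <= index y L].

Definition lt_in L x y : bool :=
  [&& x \in L, y \in L & index x L < index y L].

Definition ple L : Prop :=
  uniq L /\ {in L &, forall x y, (x <= y)%O -> le_in L x y}.

Definition mu_at u Ls : nat := count (fun L => u \in L) Ls.

Definition mu Ls : nat := \max_(u : P) mu_at u Ls.

Definition local_realizer Ls : Prop :=
  [/\ Ls <> [::],
      {in Ls, forall L, ple L},
      forall x y, (x <= y)%O -> exists2 L, L \in Ls & le_in L x y
    & forall x y, (x >< y)%O -> exists2 L, L \in Ls & lt_in L y x].

Lemma ex_local_realizer : exists Ls, local_realizer Ls.
Proof.
pose c x y := if (x < y)%O then [:: x; y]
              else if (x >< y)%O then [:: y; x] else [:: x].
exists ([::] :: [seq c x y | x <- enum P, y <- enum P]).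
have cin x y : c x y \in [::] :: [seq c x y | x <- enum P, y <- enum P].
  by rewrite inE allpairs_f ?orbT // mem_enum.
split=> //.
- move=> L; rewrite inE => /orP[/eqP->|/allpairsP[[x y] /= [_ _ ->]]] //.
  rewrite /c; case: ifP => [xy|_]; last case: ifP => [xy|_]; split=> //=.
  + by rewrite inE (lt_eqF xy).
  + move=> a b; rewrite !inE /le_in /= !inE.
    move=> /orP[] /eqP-> /orP[] /eqP->; rewrite ?eqxx ?orbT ?(gt_eqF xy) ?leqnn //.
    by rewrite (lt_geF xy).
  + by rewrite inE andbT; apply: contraNN xy => /eqP->; rewrite comparablexx.
  + have yx : (y == x) = false.
      by apply: contraNF xy => /eqP->; rewrite comparablexx.
    move=> a b; rewrite !inE /le_in /= !inE.
    move=> /orP[] /eqP-> /orP[] /eqP->; rewrite ?eqxx ?orbT ?yx ?leqnn //.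
    by move=> le; move: xy; rewrite /Order.comparable le.
  + by move=> a b; rewrite !inE /le_in /= !inE => /eqP-> /eqP->; rewrite eqxx.
- move=> x y; rewrite le_eqVlt => /orP[/eqP<-|xy].
    by exists (c x x) => //; rewrite /c ltxx comparablexx /le_in inE eqxx leqnn.
  exists (c x y) => //.
  by rewrite /c xy /le_in /= !inE !eqxx orbT.
- move=> x y xy; exists (c x y) => //.
  have nlt : (x < y)%O = false.
    by apply: contraNF xy => /ltW; rewrite /Order.comparable => ->.
  have yx : (y == x) = false.
    by apply: contraNF xy => /eqP->; rewrite comparablexx.
  by rewrite /c nlt xy /lt_in /= !inE !eqxx orbT yx.
Qed.

Lemma ex_mu : exists n, `[< exists Ls, local_realizer Ls /\ mu Ls = n >].
Proof.
by have [Ls Lr] := ex_local_realizer; exists (mu Ls); apply/asboolP; exists Ls.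
Qed.

End Poset.

Definition ldim {disp : Order.disp_t} (P : finPOrderType disp) : nat :=
  ex_minn (@ex_mu disp P).

Definition acyclic (I : finType) (e : rel I) : Prop :=
  forall c : seq I, 2 < size c -> ~ ucycle e c.

Definition is_tree (I : finType) (e : rel I) : Prop :=
  [/\ 0 < #|I|, symmetric e, irreflexive e,
      (forall i j, connect e i j) & acyclic e].

Definition tree_decomposition (V : finType) (g : rel V)
    (I : finType) (t : rel I) (B : I -> {set V}) : Prop :=
  [/\ is_tree t,
      forall v, exists i, v \in B i,
      forall u v, g u v -> exists i, (u \in B i) && (v \in B i)
    & forall v i j, v \in B i -> v \in B j ->
        connect [rel a b | [&& t a b, v \in B a & v \in B b]] i j].

(* Because of the truncated predecessor, the graph without vertices has
   tree-width 0 here, rather than -1. *)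
Definition width (V I : finType) (B : I -> {set V}) : nat :=
  (\max_(i : I) #|B i|).-1.

Lemma ex_width (V : finType) (g : rel V) :
  exists n, `[< exists (I : finType) (t : rel I) (B : I -> {set V}),
                  tree_decomposition g t B /\ width B = n >].
Proof.
exists (width (fun _ : unit => [set: V])); apply/asboolP.
exists unit, (fun _ _ => false), (fun=> [set: V]); split=> //; split.
- split=> //; first by rewrite card_unit.
  + by move=> [] []; apply: connect0.
  + by move=> [|[] [|[] s]].
- by move=> v; exists tt; rewrite inE.
- by move=> u v _; exists tt; rewrite !inE.
- by move=> v [] [] _ _; apply: connect0.
Qed.

Definition treewidth (V : finType) (g : rel V) : nat := ex_minn (ex_width g).

(* Main.v *)
(* The poset is a tree of Kelly gadgets. A gadget has a chain
   ... < x_2 < x_1 < x_0, a chain y_0 < y_1 < ..., and for each i elements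
   a_i < x_i, y_(i+1) and b_i > x_(i+1), y_i, so that a_i < b_j iff i <> j.
   Each a_i is identified with the top x_0 of the chain x of another gadget,
   and so on down to depth n; as gadgets only share cut vertices, eliminating
   them from the root downwards keeps the fronts at size at most 3.

   The deepest x_0 below a_i is incomparable to b_i, and a ple that puts some
   element z <= a_i above b_i cannot do so for two values of i in the same
   gadget. Suppose every element is in at most d ple's and walk down from the
   root. The elements b_i selected so far lie in at most d n ple's; if gadgets
   have more than d n branches, one can select a branch i such that none of
   these ple's reverses it. The ple's reversing the n branches selected along
   the path are then distinct, and all of them contain the last x_0, so that
   n <= d. *)

Require Import Defs.
From HB Require Import structures.
From mathcomp Require Import all_boot all_order.
From mathcomp Require Import boolp zify.

Set Implicit Arguments.
Unset Strict Implicit.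
Unset Printing Implicit Defensive.

Import Order.TTheory.

(** * Tree-width bounds from elimination orders *)

Section Elimination.
Variables (V : finType) (r : V) (par : V -> V) (rk : V -> nat).
Hypothesis rk_par : forall v, v != r -> rk (par v) < rk v.

Definition parent_edge : rel V :=
  [rel u v | (u != r) && (par u == v) || (v != r) && (par v == u)].

Lemma parent_edge_sym : symmetric parent_edge.
Proof. by move=> u v; rewrite /parent_edge /= orbC. Qed.

Lemma parent_edge_up u v : parent_edge u v -> rk v <= rk u -> v = par u.
Proof.
case/orP=> [/andP[_ /eqP//]|/andP[vr /eqP<-]] le_vu.
by have := rk_par vr; rewrite ltnNge le_vu.
Qed.

Lemma connect_root (e : rel V) (Q : pred V) a :
    (forall v, Q v -> v != a -> [&& v != r, e v (par v) & Q (par v)]) ->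
  forall v, Q v -> connect e v a.
Proof.
move=> step v; have [m] := ubnP (rk v); elim: m v => // m IHm v lt_vm Qv.
have [->|va] := eqVneq v a; first exact: connect0.
have /and3P[vr evp Qp] := step v Qv va.
by apply: connect_trans (connect1 evp) (IHm _ _ Qp); have := rk_par vr; lia.
Qed.

Lemma parent_edge_tree : is_tree parent_edge.
Proof.
split.
- by apply/card_gt0P; exists r.
- exact: parent_edge_sym.
- move=> v; apply/negbTE; rewrite /parent_edge /= orbb.
  by apply/andP=> -[vr /eqP pv]; have := rk_par vr; rewrite pv ltnn.
- have conn_r v : connect parent_edge v r.
    apply: (@connect_root _ predT) => // u _ ur.
    by rewrite ur /parent_edge /= ur eqxx.
  move=> u v; apply: connect_trans (conn_r u) _.
  by rewrite (sym_connect_sym parent_edge_sym).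
- move=> [//|x0 c] sz_c cyc_c.
  (* On a cycle, both neighbours of a vertex of maximal rank would be its parent. *)
  pose x := [arg max_(x > x0 in x0 :: c) rk x].
  have [x_in x_max] : x \in x0 :: c /\ {in x0 :: c, forall y, rk y <= rk x}.
    by rewrite /x; case: arg_maxnP => [|y]; rewrite ?mem_head.
  have [k s def_c] := rot_to x_in.
  have: ucycle parent_edge (x :: s) by rewrite -def_c rot_ucycle.
  have: size (x :: s) > 2 by rewrite -def_c size_rot.
  have {}x_max y : y \in s -> rk y <= rk x.
    by move=> ys; apply: x_max; rewrite -(mem_rot k) def_c inE ys orbT.
  case: s {def_c} x_max => [//|y s] x_max.
  case/lastP: s x_max => [//|s z] x_max.
  rewrite /ucycle => _ /andP[/= /andP[xy]].
  rewrite rcons_path last_rcons => /andP[_ zx] /andP[_ /andP[]].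
  have yx : y = par x by apply: parent_edge_up xy _; rewrite x_max ?mem_head.
  have zx' : z = par x.
    apply: parent_edge_up; first by rewrite parent_edge_sym.
    by rewrite x_max // inE mem_rcons mem_head orbT.
  by rewrite yx zx' mem_rcons mem_head.
Qed.

(* [N v] lists the neighbours of [v] that are alive when [v] is eliminated
   (junk occurrences of [v] itself are harmless); the decomposition tree can
   then be put on [V], with [v :: N v] as the bag of [v]. *)
Lemma treewidth_elimination (g : rel V) (N : V -> seq V) k :
    N r = [::] ->
    (forall v, v != r -> {subset N v <= [:: v, par v & N (par v)]}) ->
    (forall u v, g u v -> (u \in N v) || (v \in N u)) ->
    (forall v, size (N v) <= k) ->
  treewidth g <= k.
Proof.
move=> Nr Npar Ng Nk; rewrite /treewidth; case: ex_minnP => n _ n_min.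
pose bag v := [set w in v :: N v].
apply: leq_trans (n_min (width bag) _) _; last first.
  rewrite /width; set b := \max_(i : V) _.
  suff: b <= k.+1 by lia.
  apply/bigmax_leqP => v _; rewrite /bag cardsE.
  by apply: leq_trans (card_size _) _; rewrite ltnS.
apply/asboolP; exists V, parent_edge, bag; split=> //; split.
- exact: parent_edge_tree.
- by move=> v; exists v; rewrite !inE eqxx.
- move=> u v /Ng /orP[uv|vu]; [exists v|exists u];
    by rewrite !inE ?uv ?vu eqxx ?orbT.
- move=> v i j vi vj; set e := (X in connect X).
  have e_sym : symmetric e.
    by move=> x y; rewrite /e /= parent_edge_sym andbCA andbC -andbA.
  (* Climbing from [u] keeps [v] in the bags until [v] itself is reached. *)
  have conn_v u : v \in bag u -> connect e u v.
    apply: (@connect_root _ [pred u | v \in bag u]) => {}u /= vu uv.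
    have vN : v \in N u by move: vu; rewrite !inE eq_sym (negbTE uv).
    have ur : u != r by apply: contraTneq vN => ->; rewrite Nr.
    have vp : v \in bag (par u).
      by have := Npar _ ur _ vN; rewrite !inE eq_sym (negbTE uv).
    by rewrite /e /parent_edge /= ur eqxx vu vp.
  apply: connect_trans (conn_v i vi) _.
  by rewrite (sym_connect_sym e_sym) conn_v.
Qed.

End Elimination.

(** * The poset: a tree of Kelly gadgets *)

Inductive kind := X | Y | B.

Definition kind_code k :=
  match k with X => None | Y => Some true | B => Some false end.

Definition kind_decode c :=
  match c with None => X | Some true => Y | Some false => B end.

Lemma kind_codeK : cancel kind_code kind_decode. Proof. by case. Qed.
HB.instance Definition _ := Finite.copy kind (can_type kind_codeK).

(* The triple [(p, k, i)] is the vertex [x_i], [y_i] or [b_i] of the gadget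
   at the tree node [p]; a node is the list of the branches taken from the
   root, the last one first. The vertex [a_i] of the gadget at [p] is the
   vertex [x_0] of the gadget at [i :: p]. *)
Definition kelly_tree (n m : nat) : Type :=
  (n.-bseq 'I_m.+1 * kind * 'I_m.+1)%type.

HB.instance Definition _ n m := Finite.on (kelly_tree n m).

Section KellyTree.
Variables n m : nat.
Local Notation V := (kelly_tree n m).
Implicit Types (u v : V) (p q : seq 'I_m.+1) (i j c : 'I_m.+1).

(** [insub_bseq] returns a default when [size p > n], hence the size conditions below. *)
Definition elt p k i : V := (insub_bseq n p, k, i).

Definition node v : seq 'I_m.+1 := v.1.1.

Lemma node_elt p k i : size p <= n -> node (elt p k i) = p.
Proof. by rewrite /node /= /insub_bseq val_insubd => ->. Qed.

Lemma eltK v : elt (node v) v.1.2 v.2 = v.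
Proof. by case: v => [[p k] i]; rewrite /elt /node /insub_bseq /= valKd. Qed.

Inductive arc : V -> V -> Prop :=
  | arc_xx p i j of size p <= n & i = j.+1 :> nat : arc (elt p X i) (elt p X j)
  | arc_yy p i j of size p <= n & j = i.+1 :> nat : arc (elt p Y i) (elt p Y j)
  | arc_xb p i j of size p <= n & i = j.+1 :> nat : arc (elt p X i) (elt p B j)
  | arc_yb p i of size p <= n : arc (elt p Y i) (elt p B i)
  | arc_ax p i of size p < n : arc (elt (i :: p) X ord0) (elt p X i)
  | arc_ay p i j of size p < n & j = i.+1 :> nat :
      arc (elt (i :: p) X ord0) (elt p Y j).

Definition below : rel V := connect (fun u v => `[< arc u v >]).

Lemma arc_below u v : arc u v -> below u v.
Proof. by move=> uv; apply/connect1/asboolP. Qed.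

(** An up-set containing [u] but not [v] thus refutes [below u v]. *)
Lemma below_closed (Q : pred V) :
  (forall u v, arc u v -> Q u -> Q v) ->
  forall u v, below u v -> Q u -> Q v.
Proof.
move=> Qarc u v /connectP[s us ->]; elim: s u us => //= w s IHs u.
by case/andP=> /asboolP uw ws Qu; apply: IHs ws (Qarc _ _ uw Qu).
Qed.

(** Its growth along arcs gives antisymmetry. Each level of gadgets gets a block of [3 * m.+1]
    values, deeper levels lying lower. *)
Definition height v : nat :=
  (n - size (node v)) * (3 * m.+1) +
  match v.1.2 with X => m.+1 - v.2 | Y => v.2 | B => 2 * m.+1 end.

Lemma arc_height u v : arc u v -> height u < height v.
Proof.
case=> [p i j np ij|p i j np ij|p i j np ij|p i np|p i np|p i j np ij];
  rewrite /height !node_elt ?(ltnW np) //= ?ltn_add2l;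
  have := ltn_ord i; try have := ltn_ord j; try lia.
- by rewrite -(subnSK np) mulSn; lia.
- by rewrite -(subnSK np) mulSn; lia.
Qed.

Lemma below_height u v : below u v -> u = v \/ height u < height v.
Proof.
move=> uv; suff: (u == v) || (height u < height v).
  by case/orP; [move/eqP; left | right].
apply: (@below_closed [pred w | (u == w) || (height u < height w)]) uv _;
  rewrite /= ?eqxx // => w z /arc_height wz /orP[/eqP->|uw].
  by rewrite wz orbT.
by rewrite (ltn_trans uw wz) orbT.
Qed.

Lemma below_refl : reflexive below.
Proof. by move=> u; apply: connect0. Qed.

Lemma below_trans : transitive below.
Proof. exact: connect_trans. Qed.

Lemma below_anti : antisymmetric below.
Proof.
move=> u v /andP[/below_height[] // uv /below_height[] // vu].
by have := ltn_trans uv vu; rewrite ltnn.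
Qed.

End KellyTree.

Fact kelly_display : Order.disp_t. Proof. exact: Order.Disp tt tt. Qed.

HB.instance Definition _ n m :=
  Order.Le_isPOrder.Build kelly_display (kelly_tree n m)
    (@below_refl n m) (@below_anti n m) (@below_trans n m).

(** * Tree-width of the cover graph *)

Section TreeWidth.
Variables n m : nat.
Local Notation V := (kelly_tree n m).
Implicit Types (u v : V) (p q : seq 'I_m.+1) (i j c : 'I_m.+1).

(** The first arc of a path from [u] to [v] ends at some [w] with [u < w <= v]; a cover forces
    [w = v]. *)
Lemma cover_arc u v : covers u v -> arc u v.
Proof.
case/andP=> uv /forallP no_mid.
have /connectP[[|w s] /=] : below u v by exact: ltW uv.
  by move=> _ e; rewrite e ltxx in uv.
case/andP=> /asboolP uw ws def_v.
have w_v : below w v by apply/connectP; exists s.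
have u_w : (u < w)%O.
  rewrite lt_neqAle; apply/andP; split; last exact: arc_below.
  by apply: contraTneq (arc_height uw) => ->; rewrite ltnn.
have := no_mid w; rewrite u_w /= lt_neqAle negb_and negbK.
by case/orP=> [/eqP <- //|/negP]; case.
Qed.

(* [nxt] and [prv] are truncated: they fix [m] and [0], respectively. *)
Definition nxt i : 'I_m.+1 := inord (minn i.+1 m).
Definition prv i : 'I_m.+1 := inord i.-1.

Lemma nxtE i j : j = i.+1 :> nat -> nxt i = j.
Proof.
move=> ij; apply: val_inj; have jm := ltn_ord j.
by rewrite /= inordK; lia.
Qed.

Lemma prvE i j : j = i.+1 :> nat -> prv j = i.
Proof.
move=> ij; apply: val_inj; have jm := ltn_ord j.
by rewrite /= inordK; lia.
Qed.

Lemma prv_nxt i : (i == nxt i) || (i == prv (nxt i)).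
Proof.
have [im|mi] := ltnP i m.
  by rewrite (@prvE i) ?eqxx ?orbT // /nxt inordK; lia.
apply/orP; left; apply/eqP/val_inj; have im := ltn_ord i.
by rewrite /= inordK; lia.
Qed.

Definition root : V := elt n [::] X ord0.

(** In a gadget, the tree is the path x_0, y_0, x_1, y_1, ...; both a_i and b_i hang at y_(i+1),
    whose bag {x_i, y_i, x_(i+1), y_(i+1)} contains their neighbours in this gadget. *)
Definition parent v : V :=
  let p := node v in let i := v.2 in
  match v.1.2 with
  | X => if i == ord0 then if p is c :: q then elt n q Y (nxt c) else v
         else elt n p Y (prv i)
  | Y => elt n p X i
  | B => elt n p Y (nxt i)
  end.

Definition front v : seq V :=
  let p := node v in let i := v.2 in
  match v.1.2 with
  | X => if i == ord0 then
           if p is c :: q then [:: elt n q X c; elt n q Y (nxt c)] else [::]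
         else [:: elt n p X (prv i); elt n p Y (prv i)]
  | Y => [:: elt n p X i; elt n p X (prv i); elt n p Y (prv i)]
  | B => [:: elt n p X (nxt i); elt n p Y i]
  end.

Definition depth v : nat :=
  size (node v) * (2 * m.+1) +
  match v.1.2 with X => 2 * v.2 | Y => (2 * v.2).+1 | B => 2 * m.+1 end.

Lemma elt_ind (Q : V -> Prop) :
  (forall p k i, size p <= n -> Q (elt n p k i)) -> forall v, Q v.
Proof. by move=> Qelt v; rewrite -(eltK v); apply/Qelt/size_bseq. Qed.

Lemma depth_parent v : v != root -> depth (parent v) < depth v.
Proof.
elim/elt_ind: v => p k i np; rewrite /depth /parent node_elt //=.
have := ltn_ord i; case: k => im.
- have [i0|i0] := eqVneq i ord0; last first.
    rewrite node_elt //= /prv => _; rewrite inordK; last by lia.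
    by have : i != 0 :> nat := i0; lia.
  case: p np => [|c q] nq; first by rewrite i0 eqxx.
  rewrite node_elt ?(ltnW nq) //= /nxt inordK; last by lia.
  by rewrite i0 /= (mulSn (size q)); lia.
- by rewrite node_elt //=; lia.
- by rewrite node_elt //= /nxt inordK; lia.
Qed.

Lemma front_parent v :
  v != root -> {subset front v <= [:: v, parent v & front (parent v)]}.
Proof.
elim/elt_ind: v => p k i np _ w; rewrite /front /parent node_elt //=; case: k.
- have [i0|i0] := eqVneq i ord0; last first.
    by rewrite node_elt //= !inE => /orP[]/eqP->; rewrite eqxx ?orbT.
  case: p np => [//|c q] nq; rewrite node_elt ?(ltnW nq) //= !inE.
  case/orP=> /eqP->; rewrite ?eqxx ?orbT //.
  by case/orP: (prv_nxt c) => /eqP <-; rewrite eqxx ?orbT.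
- rewrite node_elt //= !inE.
  have [i0|i0] := eqVneq i ord0.
    have -> : prv i = i by apply: val_inj; rewrite /= inordK i0.
    by case/or3P=> /eqP->; rewrite eqxx ?orbT.
  by rewrite !inE; case/or3P=> /eqP->; rewrite eqxx ?orbT.
- rewrite node_elt //= !inE => /orP[]/eqP->; rewrite ?eqxx ?orbT //.
  by case/orP: (prv_nxt i) => /eqP <-; rewrite eqxx ?orbT.
Qed.

Lemma arc_front u v : arc u v -> (u \in front v) || (v \in front u).
Proof.
case=> [p i j np ij|p i j np ij|p i j np ij|p i np|p i np|p i j np ij];
  rewrite /front !node_elt ?(ltnW np) //=.
- have -> : (i == ord0) = false by apply/eqP=> i0; rewrite i0 in ij.
  by rewrite (prvE ij) !inE eqxx orbT.
- by rewrite (prvE ij) !inE eqxx ?orbT.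
- by rewrite (nxtE ij) !inE eqxx ?orbT.
- by rewrite !inE eqxx ?orbT.
- by rewrite !inE eqxx ?orbT.
- by rewrite (nxtE ij) !inE eqxx ?orbT.
Qed.

Lemma treewidth_kelly : treewidth (@cover_graph _ V) <= 3.
Proof.
apply: (@treewidth_elimination _ root parent depth depth_parent _ front).
- by rewrite /front node_elt.
- exact: front_parent.
- by move=> u v /orP[] /cover_arc /arc_front //; rewrite orbC.
- move=> v; rewrite /front; case: v.1.2 => //; case: eqP => // _.
  by case: node.
Qed.

End TreeWidth.

(** * Comparable and incomparable pairs *)

Lemma suffix_consr (T : eqType) (s t : seq T) x :
  suffix s (x :: t) = (s == x :: t) || suffix s t.
Proof.
apply/idP/orP=> [/suffixP[[|y r]] /= e|[/eqP->|/suffixP[r ->]]].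
- by left; rewrite e.
- by case: e => _ ->; right; apply: suffix_suffix.
- exact: suffix_refl.
- by rewrite -cat_cons suffix_suffix.
Qed.

Section Comparabilities.
Variables n m : nat.
Local Notation V := (kelly_tree n m).
Implicit Types (u v : V) (p q : seq 'I_m.+1) (i j c : 'I_m.+1).

Lemma below_x p i j :
  size p <= n -> j <= i -> below (elt n p X i) (elt n p X j).
Proof.
move=> np; case: i => i; elim: i => [|i IHi] im /= ji.
  by have -> : j = Ordinal im; [apply: val_inj => /=; lia | exact: below_refl].
have [->|ne_ji] := eqVneq j (Ordinal im); first exact: below_refl.
have {ne_ji} : j != i.+1 :> nat := ne_ji; have im' := ltnW im => ne_ji.
have arc_i := @arc_xx n m p (Ordinal im) (Ordinal im') np erefl.
by apply: below_trans (arc_below arc_i) (IHi im' _); rewrite /=; lia.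
Qed.

Lemma below_y p i j :
  size p <= n -> i <= j -> below (elt n p Y i) (elt n p Y j).
Proof.
move=> np; case: j => j; elim: j => [|j IHj] jm /= ij.
  by have -> : i = Ordinal jm; [apply: val_inj => /=; lia | exact: below_refl].
have [->|ne_ij] := eqVneq i (Ordinal jm); first exact: below_refl.
have {ne_ij} : i != j.+1 :> nat := ne_ij; have jm' := ltnW jm => ne_ij.
have arc_j := @arc_yy n m p (Ordinal jm') (Ordinal jm) np erefl.
by apply: below_trans (IHj jm' _) (arc_below arc_j); rewrite /=; lia.
Qed.

Lemma below_ancestor p q :
  size p <= n -> suffix q p -> below (elt n p X ord0) (elt n q X ord0).
Proof.
elim: p => [|c p IHp] np.
  by rewrite suffixs0 => /eqP->; apply: below_refl.
rewrite suffix_consr => /orP[/eqP->|qp]; first exact: below_refl.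
apply: below_trans (IHp (ltnW np) qp).
by apply: below_trans (arc_below (arc_ax _ np)) (below_x (ltnW np) _).
Qed.

(** If i < j, then a_i < y_(i+1) <= y_j < b_j; if j < i, then a_i < x_i <= x_(j+1) < b_j. *)
Lemma below_branch q i j :
  size q < n -> i != j -> below (elt n (i :: q) X ord0) (elt n q B j).
Proof.
move=> nq; have nq' := ltnW nq; have im := ltn_ord i; have jm := ltn_ord j.
rewrite -val_eqE neq_ltn => /orP[/= ij|/= ji].
  have [k ij'] : exists k : 'I_m.+1, k = i.+1 :> nat
    by exists (inord i.+1); rewrite inordK //; lia.
  apply: below_trans (arc_below (arc_ay nq ij')) _.
  apply: below_trans (arc_below (arc_yb j nq')).
  by apply: below_y; rewrite ?ij'.
have [k ji'] : exists k : 'I_m.+1, k = j.+1 :> nat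
    by exists (inord j.+1); rewrite inordK //; lia.
apply: below_trans (arc_below (arc_ax i nq)) _.
apply: below_trans (arc_below (arc_xb nq' ji')).
by apply: below_x; rewrite ?ji'.
Qed.

(* An up-set separating the subtree hanging at [i :: q] from [b_i]. *)
Definition above_branch q i : pred V := fun v =>
  [|| suffix (i :: q) (node v), ~~ suffix q (node v)
    | (node v == q) &&
      match v.1.2 with X => v.2 <= i | Y => i < v.2 | B => v.2 != i end].

Lemma above_branch_closed q i u v :
  arc u v -> above_branch q i u -> above_branch q i v.
Proof.
have sz p : suffix (i :: q) p -> size q < size p by move=> /size_suffix.
case=> [p j k np jk|p j k np jk|p j k np jk|p j np|p j np|p j k np jk];
  rewrite /above_branch !node_elt ?(ltnW np) //=.
- by case/or3P=> [->|->|/andP[-> ?]]; rewrite ?orbT //; apply/or3P/Or33; lia.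
- by case/or3P=> [->|->|/andP[-> ?]]; rewrite ?orbT //; apply/or3P/Or33; lia.
- case/or3P=> [->|->|/andP[-> ?]]; rewrite ?orbT //; apply/or3P/Or33.
  by rewrite -val_eqE /=; lia.
- case/or3P=> [->|->|/andP[-> ?]]; rewrite ?orbT //; apply/or3P/Or33.
  by rewrite -val_eqE /=; lia.
- rewrite !suffix_consr eqseq_cons negb_or.
  case/or3P=> [/orP[/andP[/eqP-> /eqP->]|->]|/andP[_ ->]|/andP[/eqP<- _]];
    rewrite ?eqxx ?leqnn ?orbT //.
  (* Here [q = j :: p]: the arc leaves the subtree of [q], so its end satisfies the second
     clause. *)
  by apply/or3P/Or32; apply/negP => /size_suffix /=; rewrite ltnn.
- rewrite !suffix_consr eqseq_cons negb_or.
  case/or3P=> [/orP[/andP[/eqP-> /eqP->]|->]|/andP[_ ->]|/andP[/eqP<- _]];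
    rewrite ?eqxx ?jk ?leqnn ?orbT //.
  by apply/or3P/Or32; apply/negP => /size_suffix /=; rewrite ltnn.
Qed.

Lemma branch_incomparable p q i :
  size p <= n -> suffix (i :: q) p -> (elt n p X ord0 >< elt n q B i)%O.
Proof.
move=> np qp; have nq : size q <= n by have := size_suffix qp => /=; lia.
rewrite /Order.comparable negb_or; apply/andP; split; apply/negP => le_uv.
  have := below_closed (@above_branch_closed q i) le_uv.
  rewrite /above_branch !node_elt //= qp /= suffix_refl !eqxx /=.
  by move/(_ isT); rewrite orbF => /size_suffix /=; rewrite ltnn.
(* No arc leaves a vertex of kind [B], so b_i is maximal. *)
suff : [pred w : V | w.1.2 == B] (elt n p X ord0) by [].
by apply: below_closed le_uv _ => // u v [].
Qed.

End Comparabilities.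

(** * Lower bound for local realizers *)

Section Realizer.
Variables (n m d : nat) (Ls : seq (seq (kelly_tree n m))).
Hypotheses (Ls_real : local_realizer Ls) (mu_Ls : mu Ls <= d).
Local Notation V := (kelly_tree n m).
Implicit Types (u v : V) (L : seq V) (p q : seq 'I_m.+1) (i j c : 'I_m.+1).

(** A ple may omit a_i itself, so any element below a_i, such as a deeper x_0, can serve as [z]. *)
Definition reverses L q i : Prop :=
  exists2 z : V, (z <= elt n (i :: q) X ord0)%O & lt_in L (elt n q B i) z.

(* Otherwise [z_i <= b_j < z_j <= b_i < z_i] in [L]. *)
Lemma reverses_inj L q i j :
  L \in Ls -> size q < n -> reverses L q i -> reverses L q j -> i = j.
Proof.
case: Ls_real => _ Ls_ple _ _ /Ls_ple[_ L_mono] nq.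
case=> [z zi /and3P[bi_L z_L bi_z]] [w wj /and3P[bj_L w_L bj_w]].
apply/eqP; apply: contraT => ij.
have /and3P[_ _ zb] := L_mono _ _ z_L bj_L (le_trans zi (below_branch nq ij)).
rewrite eq_sym in ij.
have /and3P[_ _ wb] := L_mono _ _ w_L bi_L (le_trans wj (below_branch nq ij)).
by lia.
Qed.

Fixpoint used p : seq (seq V) :=
  if p is i :: q then [seq L <- Ls | elt n q B i \in L] ++ used q else [::].

Fixpoint fresh p : Prop :=
  if p is i :: q then (forall L, L \in used q -> ~ reverses L q i) /\ fresh q
  else True.

Lemma mu_at_le u : mu_at u Ls <= d.
Proof. by apply: leq_trans mu_Ls; apply: (leq_bigmax u). Qed.

Lemma size_used p : size (used p) <= d * size p.
Proof.
elim: p => //= i p IHp; rewrite size_cat size_filter mulnS leq_add //.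
exact: mu_at_le.
Qed.

Lemma used_sub p : {subset used p <= Ls}.
Proof.
elim: p => //= i p IHp L; rewrite mem_cat mem_filter.
by case/orP=> [/andP[]|/IHp].
Qed.

(** Pigeonhole: if used ple's reversed all [m.+1] branches, they would be distinct by
    [reverses_inj], but [used q] has at most [d * n <= m] entries. *)
Lemma ex_fresh k : d * n <= m -> k <= n -> exists2 p, size p = k & fresh p.
Proof.
move=> dnm; elim: k => [|k IHk] kn; first by exists [::].
have [q q_k q_fresh] := IHk (ltnW kn).
have [[i i_fresh]|no_i] :=
  pselect (exists i, forall L, L \in used q -> ~ reverses L q i).
  by exists (i :: q); rewrite /= ?q_k.
have /choice[f f_rev] : forall i, exists L, L \in used q /\ reverses L q i.
  move=> i; apply: contrapT => no_L; apply: no_i; exists i => L Lq L_rev.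
  by apply: no_L; exists L.
have f_inj : injective f.
  move=> i j fij; have [fi_used fi_rev] := f_rev i; have [_ fj_rev] := f_rev j.
  rewrite -fij in fj_rev.
  by apply: reverses_inj (used_sub fi_used) _ fi_rev fj_rev; rewrite q_k.
have : size [seq f i | i <- enum 'I_m.+1] <= size (used q).
  apply: uniq_leq_size; first by rewrite map_inj_uniq ?enum_uniq.
  by move=> L /mapP[i _ ->]; case: (f_rev i).
rewrite size_map size_enum_ord => m_used.
have := size_used q; rewrite q_k => used_k.
have : d * k <= d * n by rewrite leq_mul // ltnW.
by lia.
Qed.

(** Induction on [q] with [p] fixed, so that all ple's found contain the same x_0. The one reversing
    branch [i] is new, as no member of [used q] does so; containing b_i, it lies in
    [used (i :: q)]. *)
Lemma fresh_distinct p q :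
    size p <= n -> suffix q p -> fresh q ->
  exists s, [/\ uniq s, size s = size q, {subset s <= used q}
              & {subset s <= [seq L <- Ls | elt n p X ord0 \in L]}].
Proof.
move=> np; elim: q => [|i q IHq] qp; first by exists [::].
case=> i_fresh q_fresh.
have [|s [s_uniq s_size s_used s_p]] := IHq _ q_fresh.
  by apply: suffix_trans qp; apply: suffix_cons.
have [_ _ _ /(_ _ _ (branch_incomparable np qp))[L L_Ls L_rev]] := Ls_real.
have /and3P[b_L x_L _] := L_rev.
exists (L :: s); split.
- rewrite /= s_uniq andbT; apply/negP => /s_used/i_fresh; apply.
  by exists (elt n p X ord0) => //; apply: below_ancestor.
- by rewrite /= s_size.
- move=> K; rewrite inE mem_cat mem_filter => /orP[/eqP->|/s_used->].
    by rewrite b_L L_Ls.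
  by rewrite orbT.
- move=> K; rewrite inE mem_filter => /orP[/eqP->|].
    by rewrite x_L L_Ls.
  by move/s_p; rewrite mem_filter.
Qed.

Lemma realizer_level_bound : d * n <= m -> n <= d.
Proof.
move=> dnm; have [p p_n p_fresh] := ex_fresh dnm (leqnn n).
have np : size p <= n by rewrite p_n.
have [s [s_uniq s_size _ s_p]] := fresh_distinct np (suffix_refl p) p_fresh.
have s_n : size s = n by rewrite s_size.
apply: leq_trans (mu_at_le (elt n p X ord0)).
by rewrite -[X in X <= _]s_n /mu_at -size_filter uniq_leq_size.
Qed.

End Realizer.

Theorem theorem5p2 (d : nat) (hd : 1 <= d) :
  exists (disp : Order.disp_t) (P : finPOrderType disp),
    d < ldim P /\ treewidth (@cover_graph disp P) <= 3.
Proof.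
(* Depth [n = d.+1] violates [n <= d], and [d * d.+1] is the least [m] with [d * n <= m]. *)
exists kelly_display, (kelly_tree d.+1 (d * d.+1)).
split; last exact: treewidth_kelly.
rewrite /ldim; case: ex_minnP => k /asboolP[Ls [Ls_real mu_Ls]] _.
rewrite ltnNge; apply/negP => k_d; rewrite -mu_Ls in k_d.
by have := realizer_level_bound Ls_real k_d (leqnn _); rewrite ltnn.
Qed.
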